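(* Consider a commutative diagram in $\mathcal{C}$ $$\begin{array}{ccccc} K & \xrightarrow{u} & K' & \xrightarrow{u'} & K'' \\ {\scriptstyle k}\downarrow & & {\scriptstyle k'}\downarrow & & {\scriptstyle k''}\downarrow \\ A & \xrightarrow{a} & A' & \xrightarrow{a'} & A'' \\ {\scriptstyle f}\downarrow & & {\scriptstyle f'}\downarrow & & {\scriptstyle f''}\downarrow \\ B & \xrightarrow{b} & B' & \xrightarrow{b'} & B'' \end{array}$$ whose three columns are $\mathcal{Z}$-exact and such that $\mathsf{Z}(B') \cong \mathsf{Z}(B'') \cong \mathsf{Z}(A'')$. Then: (a) if $\mathsf{Z}(B) \cong \mathsf{Z}(B')$ and the first two rows are $\mathcal{Z}$-exact, then the third row is also $\mathcal{Z}$-exact; (b) if the last two rows are $\mathcal{Z}$-exact, then the first row is also $\mathcal{Z}$-exact; (c) if $a'a$ factors through $\mathcal{Z}$ and the first and the last rows are $\mathcal{Z}$-exact, then the middle row is also $\mathcal{Z}$-exact.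
   Context: $\mathcal{C}$ is a regular protomodular category equipped with a full subcategory $\mathcal{Z}$ such that: $\mathcal{Z}$ is posetal (there is at most one morphism between any two objects of $\mathcal{Z}$); $\mathcal{Z}$ is monocoreflective, i.e. the inclusion $\mathcal{Z} \hookrightarrow \mathcal{C}$ has a right adjoint (the coreflector) $\mathsf{Z} \colon \mathcal{C} \to \mathcal{Z}$ whose counit components $\varepsilon_A \colon \mathsf{Z}(A) \to A$ are monomorphisms; and $\mathsf{Z}$ inverts monomorphisms, i.e. if $m$ is a monomorphism in $\mathcal{C}$ then $\mathsf{Z}(m)$ is an isomorphism. Without loss of generality $\mathsf{Z}$ is the identity on $\mathcal{Z}$. A morphism factors through $\mathcal{Z}$ if it factors through some object of $\mathcal{Z}$; $\mathcal{N}_{\mathcal{Z}}$ denotes the class of such morphisms. A $\mathcal{Z}$-kernel of $f \colon A \to B$ is a morphism $k \colon K \to A$ such that $fk \in \mathcal{N}_{\mathcal{Z}}$ and, whenever $e \colon E \to A$ satisfies $fe \in \mathcal{N}_{\mathcal{Z}}$, there is a unique $\varphi \colon E \to K$ with $k\varphi = e$. A sequence $A \xrightarrow{k} B \xrightarrow{f} C$ is (short) $\mathcal{Z}$-exact if $f$ is a regular epimorphism and $k$ is the $\mathcal{Z}$-kernel of $f$. *)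

(* Defs.v *)
From Stdlib Require Import ProofIrrelevance.

Set Implicit Arguments.
Unset Strict Implicit.
Unset Printing Implicit Defensive.

Declare Scope cat_scope.
Delimit Scope cat_scope with cat.
Local Open Scope cat_scope.

Record category : Type := Category {
  ob :> Type;
  hom : ob -> ob -> Type;
  idm : forall A : ob, hom A A;
  comp : forall A B D : ob, hom B D -> hom A B -> hom A D;
  comp_idl : forall (A B : ob) (f : hom A B), comp (idm B) f = f;
  comp_idr : forall (A B : ob) (f : hom A B), comp f (idm A) = f;
  comp_assoc : forall (A B D E : ob) (h : hom D E) (g : hom B D) (f : hom A B),
    comp h (comp g f) = comp (comp h g) f
}.

Arguments hom {c} A B.
Arguments idm {c} A.
Arguments comp {c A B D} g f.

Notation "g ∘ f" := (comp g f) (at level 40, left associativity) : cat_scope.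

Section Morphisms.

Variable C : category.
Implicit Types A B D E : C.

Definition is_iso A B (f : hom A B) : Prop :=
  exists g : hom B A, g ∘ f = idm A /\ f ∘ g = idm B.

Definition isomorphic A B : Prop := exists f : hom A B, is_iso f.

Definition is_mono A B (m : hom A B) : Prop :=
  forall E (x y : hom E A), m ∘ x = m ∘ y -> x = y.

Definition is_coequalizer A B D (x y : hom A B) (q : hom B D) : Prop :=
  q ∘ x = q ∘ y /\
  forall E (h : hom B E), h ∘ x = h ∘ y -> exists! t : hom D E, t ∘ q = h.

Definition is_regular_epi B D (q : hom B D) : Prop :=
  exists (A : C) (x y : hom A B), is_coequalizer x y q.

Definition is_pullback A B D (f : hom A D) (g : hom B D)
    P (p : hom P A) (q : hom P B) : Prop :=
  f ∘ p = g ∘ q /\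
  forall E (x : hom E A) (y : hom E B), f ∘ x = g ∘ y ->
    exists! t : hom E P, p ∘ t = x /\ q ∘ t = y.

Definition is_terminal A : Prop := forall E, exists! t : hom E A, True.

End Morphisms.

Definition posetal (C : category) : Prop :=
  forall (A B : C) (f g : hom A B), f = g.

Definition has_pullbacks (C : category) : Prop :=
  forall (A B D : C) (f : hom A D) (g : hom B D),
    exists (P : C) (p : hom P A) (q : hom P B), is_pullback f g p q.

Definition finitely_complete (C : category) : Prop :=
  (exists A : C, is_terminal A) /\ has_pullbacks C.

Record regular_category (C : category) : Prop := RegularCategory {
  regular_finitely_complete : finitely_complete C;
  regular_kernel_pair_coequalizer :
    forall (A B R : C) (f : hom A B) (p q : hom R A),
      is_pullback f f p q ->
      exists (D : C) (e : hom A D), is_coequalizer p q e;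
  regular_epi_pullback_stable :
    forall (A B D P : C) (f : hom A D) (g : hom B D)
      (p : hom P A) (q : hom P B),
      is_pullback f g p q -> is_regular_epi f -> is_regular_epi q
}.

Record point (C : category) (B : C) : Type := Point {
  pt_ob : C;
  pt_map : hom pt_ob B;
  pt_sec : hom B pt_ob;
  pt_mapK : pt_map ∘ pt_sec = idm B
}.

Record point_hom (C : category) (B : C) (p q : point B) : Type := PointHom {
  pt_arr :> hom (pt_ob p) (pt_ob q);
  pt_arr_map : pt_map q ∘ pt_arr = pt_map p;
  pt_arr_sec : pt_arr ∘ pt_sec p = pt_sec q
}.

Lemma point_hom_eq (C : category) (B : C) (p q : point B)
  (h h' : point_hom p q) : pt_arr h = pt_arr h' -> h = h'.
Proof.
destruct h as [h hm hs], h' as [h' hm' hs']; simpl; intro e; subst h'.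
f_equal; apply proof_irrelevance.
Qed.

Definition point_id (C : category) (B : C) (p : point B) : point_hom p p :=
  PointHom (comp_idr (pt_map p)) (comp_idl (pt_sec p)).

Definition point_comp (C : category) (B : C) (p q r : point B)
  (g : point_hom q r) (f : point_hom p q) : point_hom p r.
Proof.
refine (@PointHom C B p r (g ∘ f) _ _).
- now rewrite comp_assoc, !pt_arr_map.
- now rewrite <- comp_assoc, !pt_arr_sec.
Defined.

Definition Pt (C : category) (B : C) : category.
Proof.
refine (@Category (point B) (@point_hom C B) (@point_id C B)
  (@point_comp C B) _ _ _); intros; apply point_hom_eq; simpl.
- apply comp_idl.
- apply comp_idr.
- apply comp_assoc.
Defined.

(** [t] exhibits the point [p'] over [E] as the change of base of [p] along
    [v]: the square on the projections is a pullback, and the section of [p']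
    is the one induced by the section of [p]. *)
Definition is_base_change (C : category) (E B : C) (v : hom E B)
    (p : Pt B) (p' : Pt E) (t : hom (pt_ob p') (pt_ob p)) : Prop :=
  is_pullback (pt_map p) v t (pt_map p') /\
  t ∘ pt_sec p' = pt_sec p ∘ v.

(** Conservativity of the change-of-base functors [Pt B -> Pt E].  Pullbacks
    are not chosen, so no functor is singled out: the condition is imposed on
    every value [h'] at [h] of a change of base along [v]. *)
Record protomodular_category (C : category) : Prop := ProtomodularCategory {
  protomodular_pullback : forall (E B : C) (v : hom E B) (p : Pt B),
    exists (P : C) (t : hom P (pt_ob p)) (q : hom P E),
      is_pullback (pt_map p) v t q;
  protomodular_conservative :
    forall (E B : C) (v : hom E B) (p q : Pt B) (p' q' : Pt E)
      (t : hom (pt_ob p') (pt_ob p)) (s : hom (pt_ob q') (pt_ob q)),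
      is_base_change v t -> is_base_change v s ->
      forall (h : hom p q) (h' : hom p' q'),
        s ∘ pt_arr h' = pt_arr h ∘ t ->
        is_iso h' -> is_iso h
}.

Record functor (C D : category) : Type := Functor {
  fob :> C -> D;
  fmap : forall A B : C, hom A B -> hom (fob A) (fob B);
  fmap_id : forall A : C, fmap (idm A) = idm (fob A);
  fmap_comp : forall (A B E : C) (g : hom B E) (f : hom A B),
    fmap (g ∘ f) = fmap g ∘ fmap f
}.

Arguments fmap {C D} f {A B} g : rename.

Record adjunction (D C : category) (F : functor D C) (G : functor C D) : Type :=
  Adjunction {
  unit : forall X : D, hom X (G (F X));
  counit : forall A : C, hom (F (G A)) A;
  unit_natural : forall (X Y : D) (f : hom X Y),
    unit Y ∘ f = fmap G (fmap F f) ∘ unit X;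
  counit_natural : forall (A B : C) (f : hom A B),
    counit B ∘ fmap F (fmap G f) = f ∘ counit A;
  counit_unit : forall X : D, counit (F X) ∘ fmap F (unit X) = idm (F X);
  unit_counit : forall A : C, fmap G (counit A) ∘ unit (G A) = idm (G A)
}.

Definition full_subcategory (C : category) (Z : C -> Prop) : category :=
  @Category {A : C | Z A}
    (fun X Y => hom (proj1_sig X) (proj1_sig Y))
    (fun X => idm (proj1_sig X))
    (fun X Y W g f => g ∘ f)
    (fun X Y f => comp_idl f)
    (fun X Y f => comp_idr f)
    (fun X Y W V h g f => comp_assoc h g f).

Definition inclusion (C : category) (Z : C -> Prop) :
    functor (full_subcategory Z) C :=
  @Functor (full_subcategory Z) C (fun X => proj1_sig X)
    (fun X Y f => f) (fun X => eq_refl) (fun X Y W g f => eq_refl).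

Definition inverts_monos (C D : category) (F : functor C D) : Prop :=
  forall (A B : C) (m : hom A B), is_mono m -> is_iso (fmap F m).

Section RelativeExactness.

Variables (C : category) (Z : C -> Prop).
Implicit Types A B D : C.

Definition factors_through A B (f : hom A B) : Prop :=
  exists (X : C) (g : hom A X) (h : hom X B), Z X /\ f = h ∘ g.

Definition is_Zkernel K A B (k : hom K A) (f : hom A B) : Prop :=
  factors_through (f ∘ k) /\
  forall (E : C) (e : hom E A), factors_through (f ∘ e) ->
    exists! phi : hom E K, k ∘ phi = e.

Definition Zexact A B D (k : hom A B) (f : hom B D) : Prop :=
  is_regular_epi f /\ is_Zkernel k f.

End RelativeExactness.

(* Main.v *)
(** Write [ε] for the counit of the coreflection.  A morphism is null (factors
    through [Z]) iff it factors through [ε] at its codomain, so a [Z]-kernel is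
    a pullback of [ε].  The key consequence of protomodularity is that, given
    [m : I -> Q] over [X] with [I -> X] a regular epimorphism, [m] is invertible
    as soon as its pullback along some [Y -> X] is.  Applied to the subobjects
    through which a morphism [c] factors, this shows that [c] is a regular
    epimorphism if its pullback along [Y -> X] is.  For (b) and (c) take for
    [c] the comparison from [A'] to the pullback of [b'] and [f'']: pulled back
    along [ε] it is [f] over [A''], and [u'] over [B'].  For (a), [b] is a
    monomorphism because its kernel pair is trivial over [ε], and it contains
    the [Z]-kernel of [b'] because the inverse image of the latter in [A'] is
    generated by [A] and [K']. *)

From Corelib Require Import ssreflect.
Require Import Defs.

Local Open Scope cat_scope.

(** * Monomorphisms, pullbacks and extremal epimorphisms *)

Section General.

Set Implicit Arguments.
Unset Strict Implicit.

Variable C : category.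
Implicit Types A B D E I P Q X Y : C.

(* In a regular category these are the regular epimorphisms. *)
Definition extremal_epi A B (f : hom A B) : Prop :=
  forall I (g : hom A I) (m : hom I B), is_mono m -> m ∘ g = f -> is_iso m.

Lemma pullback_lift A B D P (f : hom A D) (g : hom B D)
    (p : hom P A) (q : hom P B) E (x : hom E A) (y : hom E B) :
  is_pullback f g p q -> f ∘ x = g ∘ y ->
  exists t : hom E P, p ∘ t = x /\ q ∘ t = y.
Proof. by move=> [_ H] /H [t [Ht _]]; exists t. Qed.
Arguments pullback_lift {A B D P f g p q E} x y _ _.

Lemma pullback_ext A B D P (f : hom A D) (g : hom B D)
    (p : hom P A) (q : hom P B) E (x y : hom E P) :
  is_pullback f g p q -> p ∘ x = p ∘ y -> q ∘ x = q ∘ y -> x = y.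
Proof.
move=> [c H] Hp Hq.
have [|t [_ U]] := H E (p ∘ y) (q ∘ y); first by rewrite !comp_assoc c.
by rewrite -(U x) // -(U y).
Qed.

Lemma mono_pullback A B D P (f : hom A D) (g : hom B D)
    (p : hom P A) (q : hom P B) :
  is_pullback f g p q -> is_mono f -> is_mono q.
Proof.
move=> pb mf E x y e; apply: (pullback_ext pb) => //.
by apply: mf; rewrite !comp_assoc (proj1 pb) -!comp_assoc e.
Qed.

Lemma mono_comp A B D (g : hom B D) (f : hom A B) :
  is_mono g -> is_mono f -> is_mono (g ∘ f).
Proof. by move=> mg mf E x y; rewrite -!comp_assoc => /mg /mf. Qed.

Lemma mono_of_comp A B D (g : hom B D) (f : hom A B) :
  is_mono (g ∘ f) -> is_mono f.
Proof. by move=> m E x y e; apply: m; rewrite -!comp_assoc e. Qed.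

Lemma iso_mono A B (f : hom A B) : is_iso f -> is_mono f.
Proof.
move=> [g [gf _]] E x y e.
by rewrite -(comp_idl x) -(comp_idl y) -gf -!comp_assoc e.
Qed.

Lemma regular_epi_epi A B (q : hom A B) E (x y : hom B E) :
  is_regular_epi q -> x ∘ q = y ∘ q -> x = y.
Proof.
move=> [D [s [t [c H]]]] e.
have [|h [_ U]] := H E (y ∘ q); first by rewrite -!comp_assoc c.
by rewrite -(U x) // -(U y).
Qed.

Lemma regular_extremal A B (q : hom A B) : is_regular_epi q -> extremal_epi q.
Proof.
move=> rq I g m mm e; have [D [x [y [c H]]]] := rq.
have gxy : g ∘ x = g ∘ y by apply: mm; rewrite !comp_assoc e.
have [t [tq _]] := H I g gxy.
have mt : m ∘ t = idm B.
  by apply: (regular_epi_epi rq); rewrite -comp_assoc tq comp_idl.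
exists t; split=> //; apply: mm.
by rewrite comp_assoc mt comp_idl comp_idr.
Qed.

Lemma extremal_of_comp A B D (g : hom B D) (f : hom A B) :
  extremal_epi (g ∘ f) -> extremal_epi g.
Proof.
move=> H I h m mm e; apply: (H _ (h ∘ f) m mm).
by rewrite comp_assoc e.
Qed.

Lemma Zkernel_mono (Z : C -> Prop) A B D (k : hom A B) (f : hom B D) :
  is_Zkernel Z k f -> is_mono k.
Proof.
move=> [[X [g [h [ZX e]]]] H] E x y kxy.
have n : factors_through Z (f ∘ (k ∘ y)).
  by exists X, (g ∘ y), h; split=> //; rewrite !comp_assoc e.
by have [t [_ U]] := H E _ n; rewrite -(U x) // -(U y).
Qed.

(** * Images and extremal epimorphisms in a regular category *)

Section Regular.

Hypothesis hreg : regular_category C.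

Lemma pullback_exists A B D (f : hom A D) (g : hom B D) :
  exists P (p : hom P A) (q : hom P B), is_pullback f g p q.
Proof. exact: (proj2 (regular_finitely_complete hreg)). Qed.

(** The pullback of [m] along [g] is a monomorphism through which [r] factors, hence invertible. *)
Lemma extremal_lift A B I D (r : hom A B) (g : hom B D) (m : hom I D)
    (h : hom A I) :
  extremal_epi r -> is_mono m -> g ∘ r = m ∘ h ->
  exists l : hom B I, m ∘ l = g.
Proof.
move=> er mm e.
have [P [p [q pb]]] := pullback_exists m g.
have [t [_ qt]] := pullback_lift _ _ pb (eq_sym e).
have [n [_ qn]] := er _ t q (mono_pullback pb mm) qt.
by exists (p ∘ n); rewrite comp_assoc (proj1 pb) -comp_assoc qn comp_idr.
Qed.

Lemma extremal_comp A B D (g : hom B D) (f : hom A B) :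
  extremal_epi g -> extremal_epi f -> extremal_epi (g ∘ f).
Proof.
move=> eg ef I h m mm e.
have [l ml] := extremal_lift ef mm (eq_sym e).
exact: eg mm ml.
Qed.

Lemma image_factorization A B (f : hom A B) :
  exists D (e : hom A D) (m : hom D B),
    is_regular_epi e /\ is_mono m /\ m ∘ e = f.
Proof.
have [R [p [q pb]]] := pullback_exists f f.
have [D [e [epq He]]] := regular_kernel_pair_coequalizer hreg pb.
have [m [me _]] := He _ f (proj1 pb).
have re : is_regular_epi e by exists R, p, q.
exists D, e, m; split=> //; split=> // E x y mxy.
(* To see that [m] is a monomorphism, cover [E] by two successive pullbacks of [e], so that [x] and
   [y] both lift to [A]. The lifts agree under [f], so they form a morphism into the kernel pair,
   which [e] coequalizes. *)
have [E1 [x1 [r1 pb1]]] := pullback_exists e x.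
have [E2 [y2 [r2 pb2]]] := pullback_exists e (y ∘ r1).
have s1 := regular_epi_pullback_stable hreg pb1 re.
have s2 := regular_epi_pullback_stable hreg pb2 re.
apply: (regular_epi_epi s1); apply: (regular_epi_epi s2).
have [|t [pt qt]] :=
    pullback_lift (x1 ∘ r2) y2 pb.
  rewrite -me -!comp_assoc (proj1 pb2) !comp_assoc -(comp_assoc m e).
  by rewrite (proj1 pb1) comp_assoc mxy.
by rewrite -(proj1 pb2) -(proj1 pb1) -comp_assoc -pt -qt !comp_assoc epq.
Qed.

Lemma extremal_regular A B (f : hom A B) : extremal_epi f -> is_regular_epi f.
Proof.
have [D [e [m [[R [x [y [exy He]]]] [mm me]]]]] := image_factorization f.
move=> ef; have [n [nm mn]] := ef _ e m mm me.
exists R, x, y; split=> [|E h hxy]; first by rewrite -me -!comp_assoc exy.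
have [t [te U]] := He _ h hxy.
exists (t ∘ n); split=> [|t' t'f].
  by rewrite -comp_assoc -me (comp_assoc n) nm comp_idl.
by rewrite (U (t' ∘ m)) -?comp_assoc ?me // mn comp_idr.
Qed.

Lemma extremal_pullback A B D P (f : hom A D) (g : hom B D)
    (p : hom P A) (q : hom P B) :
  is_pullback f g p q -> extremal_epi f -> extremal_epi q.
Proof.
move=> pb /extremal_regular rf; apply: regular_extremal.
exact: regular_epi_pullback_stable hreg _ _ _ _ _ _ _ _ pb rf.
Qed.

(** * Invertibility and extremality from protomodularity *)

Hypothesis hproto : protomodular_category C.

Lemma base_change_exists X Y (v : hom Y X) (p : Pt X) :
  exists (p' : Pt Y) (t : hom (pt_ob p') (pt_ob p)), is_base_change v t.
Proof.
have [P [t [q pb]]] := protomodular_pullback hproto v p.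
have [|s [ts qs]] :=
    pullback_lift (pt_sec p ∘ v) (idm Y) pb.
  by rewrite comp_assoc pt_mapK comp_idl comp_idr.
by exists (Point qs), t.
Qed.

(* The hypothesis says that the pullback of [h] along [v] is invertible. *)
Lemma point_hom_iso X Y (v : hom Y X) (p q : Pt X) (h : hom p q) :
  (forall E (x : hom E (pt_ob q)) (y : hom E Y), pt_map q ∘ x = v ∘ y ->
     exists! t : hom E (pt_ob p), pt_arr h ∘ t = x) ->
  is_iso (pt_arr h).
Proof.
move=> H.
have [p' [t [pbt tS]]] := base_change_exists v p.
have [q' [s [pbs sS]]] := base_change_exists v q.
have [|h1 [sh qh]] := pullback_lift (pt_arr h ∘ t)
    (pt_map p') pbs.
  by rewrite comp_assoc pt_arr_map (proj1 pbt).
have hS : h1 ∘ pt_sec p' = pt_sec q'.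
  apply: (pullback_ext pbs).
    by rewrite comp_assoc sh -comp_assoc tS comp_assoc pt_arr_sec sS.
  by rewrite comp_assoc qh !pt_mapK.
pose h' : hom p' q' := PointHom qh hS.
(* The hypothesis at the projection [s] out of the base change of [q] yields the inverse [g] of
   [h1]. *)
have [g0 [hg0 _]] := H _ s (pt_map q') (proj1 pbs).
have [|g [tg pg]] := pullback_lift g0 (pt_map q') pbt.
  by rewrite -(pt_arr_map h) -comp_assoc hg0 (proj1 pbs).
have hg : h1 ∘ g = idm _.
  apply: (pullback_ext pbs).
    by rewrite comp_assoc sh -comp_assoc tg hg0 comp_idr.
  by rewrite comp_assoc qh pg comp_idr.
have gh : g ∘ h1 = idm _.
  apply: (pullback_ext pbt); last first.
    by rewrite comp_assoc pg qh comp_idr.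
  have [|w [_ U]] := H _ (pt_arr h ∘ t) (pt_map p').
    by rewrite comp_assoc pt_arr_map (proj1 pbt).
  rewrite comp_idr -[RHS]U // -[LHS]U //.
  by rewrite (comp_assoc t) tg comp_assoc hg0 sh.
have gS : g ∘ pt_sec q' = pt_sec p' by rewrite -hS comp_assoc gh comp_idl.
have isoh' : is_iso h'.
  by exists (PointHom pg gS : hom q' p'); split; apply: point_hom_eq.
have [n [nh hn]] := protomodular_conservative hproto
    (conj pbt tS) (conj pbs sS) (h := h) (h' := h') sh isoh'.
exists (pt_arr n); split.
  exact: (f_equal (@pt_arr _ _ _ _) nh).
exact: (f_equal (@pt_arr _ _ _ _) hn).
Qed.

Lemma iso_of_pullback_iso I Q X Y (m : hom I Q) (q : hom Q X) (v : hom Y X) :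
  extremal_epi (q ∘ m) ->
  (forall E (x : hom E Q) (y : hom E Y), q ∘ x = v ∘ y ->
     exists! t : hom E I, m ∘ t = x) ->
  is_iso m.
Proof.
(* Pulling back along [q ∘ m] itself turns [m] into a morphism of points. *)
move=> ep H; set p := q ∘ m.
have [R [r1 [r2 pbR]]] := pullback_exists p p.
have [S [s1 [s2 pbS]]] := pullback_exists p q.
have [J [j [j' pbJ]]] := pullback_exists p v.
have [d [d1 d2]] := pullback_lift (idm I) (idm I) pbR
    (eq_refl _).
have [|c [c1 c2]] := pullback_lift (idm I) m pbS.
  by rewrite comp_idr.
have [|h [h1 h2]] := pullback_lift r1 (m ∘ r2) pbS.
  by rewrite (proj1 pbR) comp_assoc.
have hd : h ∘ d = c.
  apply: (pullback_ext pbS).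
    by rewrite comp_assoc h1 d1 c1.
  by rewrite comp_assoc h2 -comp_assoc d2 comp_idr c2.
pose ph : hom (Point d1 : Pt I) (Point c1 : Pt I) :=
  @PointHom _ _ (Point d1) (Point c1) h h1 hd.
(* Base change along [j], the pullback of [v] along [p]: there the invertibility of [ph] reduces to
   the hypothesis on [m]. *)
have [|n [nh hn]] := point_hom_iso (v := j) (h := ph).
  move=> E x y /= sx.
  have [|t [mt U]] := H _ (s2 ∘ x) (j' ∘ y).
    by rewrite comp_assoc -(proj1 pbS) -comp_assoc sx !comp_assoc (proj1 pbJ).
  have [|w [w1 w2]] := pullback_lift (s1 ∘ x) t pbR.
    by rewrite /p -(comp_assoc q m t) mt !comp_assoc (proj1 pbS).
  exists w; split.
    apply: (pullback_ext pbS).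
      by rewrite comp_assoc h1.
    by rewrite comp_assoc h2 -comp_assoc w2.
  move=> w' hw; apply: (pullback_ext pbR).
    by rewrite w1 -hw comp_assoc h1.
  by rewrite w2; apply: U; rewrite comp_assoc -h2 -comp_assoc hw.
move: n nh hn => /= n nh hn.
(* If [m] identifies [x] and [y], then [h] identifies the pairs [(x, x)] and [(x, y)] of the kernel
   pair [R]. *)
have mm : is_mono m.
  move=> E x y mxy.
  have [w [w1 w2]] := pullback_lift x x pbR (eq_refl _).
  have [|w' [w'1 w'2]] := pullback_lift x y pbR.
    by rewrite /p -!comp_assoc mxy.
  suff e : w = w' by rewrite -w2 -w'2 e.
  have mh : is_mono h by apply: iso_mono; exists n.
  apply: mh; apply: (pullback_ext pbS).
    by rewrite !comp_assoc h1 w1 w'1.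
  by rewrite !comp_assoc h2 -!comp_assoc w2 w'2.
(* As a pullback of [p], the projection [s2] is extremal, and it factors through [m] because [h] is
   invertible. *)
have es : extremal_epi s2 := extremal_pullback pbS ep.
apply: (es _ (r2 ∘ n) m mm).
by rewrite comp_assoc -h2 -comp_assoc hn comp_idr.
Qed.

(* [t] need only be a weak pullback of [v] along [q]. *)
Lemma extremal_of_pullback_extremal A Q X Y D T (c : hom A Q) (q : hom Q X)
    (v : hom Y X) (t : hom T Q) (e : hom D T) (s : hom D A) :
  extremal_epi (q ∘ c) ->
  (forall E (x : hom E Q) (y : hom E Y), q ∘ x = v ∘ y ->
     exists z : hom E T, t ∘ z = x) ->
  extremal_epi e -> c ∘ s = t ∘ e -> extremal_epi c.
Proof.
move=> eqc H ee cs I g m mm mg.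
(* As [e] is extremal, [m] contains the whole of [t], so the pullback of [m] along [v] is
   invertible. *)
have [l ml] : exists l, m ∘ l = t.
  by apply: (extremal_lift (h := g ∘ s) ee mm); rewrite comp_assoc mg.
apply: (iso_of_pullback_iso (q := q) (v := v)).
  by apply: (extremal_of_comp (f := g)); rewrite -comp_assoc mg.
move=> E x y /H [z tz]; exists (l ∘ z); split; first by rewrite comp_assoc ml.
by move=> w mw; apply: mm; rewrite comp_assoc ml tz.
Qed.

End Regular.
End General.

Arguments pullback_lift {C A B D P f g p q E} x y _ _.

(** * Null morphisms and Z-kernels *)

Section Coreflection.

Set Implicit Arguments.
Unset Strict Implicit.

Variables (C : category) (Z : C -> Prop).
Hypothesis hreg : regular_category C.
Hypothesis hpos : posetal (full_subcategory Z).
Variable coref : functor C (full_subcategory Z).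
Variable adj : adjunction (inclusion Z) coref.
Hypothesis hcounit : forall A : C, is_mono (counit adj A).
Hypothesis hinv : inverts_monos coref.
Implicit Types A B D E : C.

Let Zo A : C := proj1_sig (coref A).
Let ε A : hom (Zo A) A := counit adj A.
Let null A B (f : hom A B) : Prop := factors_through Z f.

Lemma null_counit A B (f : hom A B) : null f <-> exists y, f = ε B ∘ y.
Proof.
split=> [[X [g [h [ZX ->]]]]|[y ->]]; last first.
  by exists (Zo B), y, (ε B); split=> //; apply: (proj2_sig (coref B)).
pose X' : full_subcategory Z := exist _ X ZX.
exists (fmap (inclusion Z) (fmap coref (h : hom (inclusion Z X') B)) ∘
  fmap (inclusion Z) (unit adj X') ∘ g).
rewrite !comp_assoc; congr (_ ∘ _).
have := counit_natural adj (h : hom (inclusion Z X') B).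
rewrite /ε => ->.
by rewrite -comp_assoc (counit_unit adj X') comp_idr.
Qed.

Lemma null_precomp A B D (g : hom B D) (f : hom A B) : null g -> null (g ∘ f).
Proof.
move=> /null_counit [y ->]; apply/null_counit.
by exists (y ∘ f); rewrite comp_assoc.
Qed.

Lemma null_postcomp A B D (g : hom B D) (f : hom A B) : null f -> null (g ∘ f).
Proof.
move=> [X [x [y [ZX ->]]]]; exists X, x, (g ∘ y).
by rewrite comp_assoc.
Qed.

Lemma isomorphic_coref_sym A B :
  isomorphic (coref A) (coref B) -> isomorphic (coref B) (coref A).
Proof. by move=> [x [y [xy yx]]]; exists y, x. Qed.

(** In a posetal category any morphism backwards is an inverse. This turns the abstract isomorphisms
    of the theorem into invertibility of the images of [b], [b'] and [f'']. *)
Lemma isomorphic_coref_iso A B (g : hom A B) :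
  isomorphic (coref A) (coref B) -> is_iso (fmap coref g).
Proof. by move=> [_ [y _]]; exists y; split; apply: hpos. Qed.

(** Null morphisms into [A] amount to morphisms into [Zo A]. So when [coref] inverts [g],
    composition with [g] is bijective on null morphisms; [null_lift] is the surjective half. *)
Lemma null_inj A B (g : hom A B) E (x y : hom E A) :
  is_iso (fmap coref g) -> null x -> null y -> g ∘ x = g ∘ y -> x = y.
Proof.
move=> [n [ng _]] /null_counit [x' ->] /null_counit [y' ->].
rewrite !comp_assoc /ε -(counit_natural adj g) -!comp_assoc => /hcounit e.
move: (f_equal (fun z => fmap (inclusion Z) n ∘ z) e); rewrite /= !comp_assoc.
have -> : (fmap (inclusion Z) n ∘ fmap (inclusion Z) (fmap coref g) = idm (Zo A)) := ng.
by rewrite !comp_idl => ->.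
Qed.

Lemma null_lift A B (g : hom A B) E (x : hom E B) :
  is_iso (fmap coref g) -> null x -> exists y : hom E A, null y /\ g ∘ y = x.
Proof.
move=> [n [_ gn]] /null_counit [x' ->].
exists (ε A ∘ (fmap (inclusion Z) n ∘ x')); split.
  by apply/null_counit; exists (fmap (inclusion Z) n ∘ x').
rewrite !comp_assoc /ε -(counit_natural adj g) -(comp_assoc (counit adj B)).
have -> : (fmap (inclusion Z) (fmap coref g) ∘ fmap (inclusion Z) n = idm (Zo B)) := gn.
by rewrite comp_idr.
Qed.

Lemma null_of_mono A B (m : hom A B) E (x : hom E A) :
  is_mono m -> null (m ∘ x) -> null x.
Proof. by move=> mm /(null_lift (hinv mm)) [y [ny /mm <-]]. Qed.

(** Nullity is a lifting through the monomorphism [ε D], so it descends along [e] by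
    [extremal_lift]. *)
Lemma null_of_extremal A B D (g : hom B D) (e : hom A B) :
  extremal_epi e -> null (g ∘ e) -> null g.
Proof.
move=> ee /null_counit [y ge]; apply/null_counit.
have [l gl] := extremal_lift hreg ee (@hcounit D) ge.
by exists l.
Qed.

Lemma Zkernel_exists A B (f : hom A B) :
  exists K (k : hom K A), is_Zkernel Z k f.
Proof.
have [K [l [k pb]]] := pullback_exists hreg (ε B) f.
have mk : is_mono k := mono_pullback pb (@hcounit B).
exists K, k; split; first by apply/null_counit; exists l; rewrite (proj1 pb).
move=> E e /null_counit [y fe].
have [t [_ kt]] := pullback_lift _ _ pb (eq_sym fe).
by exists t; split=> // t' kt'; apply: mk; rewrite kt.
Qed.

Lemma Zkernel_lift K A B (k : hom K A) (f : hom A B) E (e : hom E A) :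
  is_Zkernel Z k f -> null (f ∘ e) -> exists t, k ∘ t = e.
Proof. by move=> [_ H] /H [t [kt _]]; exists t. Qed.

Lemma mono_Zkernel K A B (k : hom K A) (f : hom A B) :
  is_mono k -> null (f ∘ k) ->
  (forall E (e : hom E A), null (f ∘ e) -> exists t, k ∘ t = e) ->
  is_Zkernel Z k f.
Proof.
move=> mk nk H; split=> // E e /H [t kt].
by exists t; split=> // t' kt'; apply: mk; rewrite kt.
Qed.

Hypothesis hproto : protomodular_category C.

(** This is [iso_of_pullback_iso] along [ε X], whose pullback along [q] is the Z-kernel of [q]. *)
Lemma iso_of_Zkernel_iso I Q X (m : hom I Q) (q : hom Q X) :
  extremal_epi (q ∘ m) ->
  (forall E (x : hom E Q), null (q ∘ x) -> exists! t : hom E I, m ∘ t = x) ->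
  is_iso m.
Proof.
move=> ee H; apply: (iso_of_pullback_iso hreg hproto (v := ε X) ee) => E x y e.
by apply: H; apply/null_counit; exists y.
Qed.

Lemma extremal_of_Zkernel_extremal A Q X D T (c : hom A Q) (q : hom Q X)
    (t : hom T Q) (e : hom D T) (s : hom D A) :
  extremal_epi (q ∘ c) ->
  (forall E (x : hom E Q), null (q ∘ x) -> exists z : hom E T, t ∘ z = x) ->
  extremal_epi e -> c ∘ s = t ∘ e -> extremal_epi c.
Proof.
move=> eq H.
apply: (extremal_of_pullback_extremal hreg hproto (v := ε X) eq) => E x y E1.
by apply: H; apply/null_counit; exists y.
Qed.

(** * The three-by-three diagram and exactness of its third row *)

Variables (K K' K'' A A' A'' B B' B'' : C).
Variables (u : hom K K') (u' : hom K' K'').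
Variables (k : hom K A) (k' : hom K' A') (k'' : hom K'' A'').
Variables (a : hom A A') (a' : hom A' A'').
Variables (f : hom A B) (f' : hom A' B') (f'' : hom A'' B'').
Variables (b : hom B B') (b' : hom B' B'').
Hypothesis sq_ka : a ∘ k = k' ∘ u.
Hypothesis sq_ka' : a' ∘ k' = k'' ∘ u'.
Hypothesis sq_fb : b ∘ f = f' ∘ a.
Hypothesis sq_fb' : b' ∘ f' = f'' ∘ a'.
Hypothesis col : Zexact Z k f.
Hypothesis col' : Zexact Z k' f'.
Hypothesis col'' : Zexact Z k'' f''.
Hypothesis Zb' : is_iso (fmap coref b').
Hypothesis Zf'' : is_iso (fmap coref f'').

Let ef : extremal_epi f := regular_extremal (proj1 col).
Let ef' : extremal_epi f' := regular_extremal (proj1 col').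
Let ef'' : extremal_epi f'' := regular_extremal (proj1 col'').
Let mk : is_mono k := Zkernel_mono (proj2 col).
Let mk' : is_mono k' := Zkernel_mono (proj2 col').
Let mk'' : is_mono k'' := Zkernel_mono (proj2 col'').
Let nk : null (f ∘ k) := proj1 (proj2 col).
Let nk' : null (f' ∘ k') := proj1 (proj2 col').
Let nk'' : null (f'' ∘ k'') := proj1 (proj2 col'').

(* [K'] meets [A] in [K], as subobjects of [A']. *)
Lemma mem_kernel_row E (x : hom E A) :
  is_Zkernel Z u u' -> null (a' ∘ a) -> is_mono a -> null (f' ∘ a ∘ x) ->
  exists z, k ∘ z = x.
Proof.
move=> ku na ma nx.
have [|y k'y] := Zkernel_lift (proj2 col') (e := a ∘ x).
  by rewrite comp_assoc.
have nu'y : null (u' ∘ y).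
  apply: (null_of_mono mk''); rewrite comp_assoc -sq_ka' -comp_assoc k'y.
  by rewrite comp_assoc; apply: null_precomp.
have [z uz] := Zkernel_lift ku nu'y.
by exists z; apply: ma; rewrite comp_assoc sq_ka -comp_assoc uz.
Qed.

Lemma third_row_mono :
  is_iso (fmap coref b) -> is_Zkernel Z u u' -> is_Zkernel Z a a' -> is_mono b.
Proof.
move=> Zb ku ka.
(* [b] reflects nullity: on the cover [e] of [E], [z] lifts to [a0] in [A], which lies in [K] by
   [mem_kernel_row]. *)
have bnull E (z : hom E B) : null (b ∘ z) -> null z.
  move=> nz.
  have [E' [a0 [e pb]]] := pullback_exists hreg f z.
  have ee : extremal_epi e := extremal_pullback hreg pb ef.
  have [|s ks] := mem_kernel_row (x := a0) ku (proj1 ka) (Zkernel_mono ka).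
    rewrite -sq_fb -comp_assoc (proj1 pb) comp_assoc; exact: null_precomp.
  apply: (null_of_extremal ee).
  rewrite -(proj1 pb) -ks comp_assoc; exact: null_precomp.
have [R [p1 [p2 pb]]] := pullback_exists hreg b b.
have [d [d1 d2]] := pullback_lift (idm B) (idm B) pb (eq_refl _).
(* It suffices to test the diagonal on pairs with null first component. Their second component is
   null too, as [b] reflects nullity, and [b] is injective on null morphisms. *)
have [n [nd dn]] : is_iso d.
  apply: (iso_of_Zkernel_iso (q := p1)).
    rewrite d1 => I g m mm mg; exists g; split=> //; apply: mm.
    by rewrite comp_assoc mg comp_idl comp_idr.
  move=> E x nx.
  have e : p1 ∘ x = p2 ∘ x.
    apply: (null_inj Zb) => //; last by rewrite !comp_assoc (proj1 pb).
    apply: bnull; rewrite comp_assoc -(proj1 pb) -comp_assoc.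
    exact: null_postcomp.
  exists (p1 ∘ x); split.
    apply: (pullback_ext pb); first by rewrite !comp_assoc d1 comp_idl.
    by rewrite !comp_assoc d2 comp_idl.
  by move=> t <-; rewrite comp_assoc d1 comp_idl.
move=> E x y bxy.
have [r [<- <-]] := pullback_lift _ _ pb bxy.
by rewrite -(comp_idl r) -dn !comp_assoc d1 d2.
Qed.

Lemma third_row_exact :
  is_iso (fmap coref b) -> Zexact Z u u' -> Zexact Z a a' -> Zexact Z b b'.
Proof.
move=> Zb [/regular_extremal eu' ku] [/regular_extremal ea' ka].
have mb := third_row_mono Zb ku ka.
have nb : null (b' ∘ b).
  apply: (null_of_extremal ef).
  rewrite -comp_assoc sq_fb comp_assoc sq_fb' -comp_assoc.
  apply: null_postcomp; exact: (proj1 ka).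
split.
  apply: (extremal_regular hreg); apply: (extremal_of_comp (f := f')).
  by rewrite sq_fb'; apply: extremal_comp.
apply: mono_Zkernel => // E e ne.
have [W [j kj]] := Zkernel_exists b'.
suff [l bl] : exists l, b ∘ l = j.
  have [t jt] := Zkernel_lift kj ne.
  by exists (l ∘ t); rewrite comp_assoc bl.
(* [P] is the inverse image in [A'] of [W], and [S] that of [B]. *)
have [P [i [r pbP]]] := pullback_exists hreg f' j.
have [S [s [m pbS]]] := pullback_exists hreg b (f' ∘ i).
have mm : is_mono m := mono_pullback pbS mb.
have [|y k''y] := Zkernel_lift (proj2 col'') (e := a' ∘ i).
  rewrite comp_assoc -sq_fb' -comp_assoc (proj1 pbP) comp_assoc.
  apply: null_precomp; exact: (proj1 kj).
have [|w jw] := Zkernel_lift kj (e := f' ∘ k'); first exact: null_postcomp.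
have [κ [iκ _]] := pullback_lift _ _ pbP (eq_sym jw).
(* [S] contains [K']: the null morphism [f' ∘ k'] lifts along [b]. Hence [y ∘ m] is extremal, since
   [u'] factors through it. *)
have [z [_ bz]] := null_lift Zb nk'.
have [|σ [_ mσ]] := pullback_lift z κ pbS; first by rewrite -comp_assoc iκ.
have ym : y ∘ m ∘ σ = u'.
  apply: mk''.
  by rewrite -(comp_assoc y) mσ comp_assoc k''y -comp_assoc iκ.
have [n [nm mn]] : is_iso m.
  apply: (iso_of_Zkernel_iso (q := y)).
    by apply: (extremal_of_comp (f := σ)); rewrite ym.
  (* [S] also contains the Z-kernel of [y]: there [a' ∘ i] is null, so [i ∘ x] comes from [A]. *)
  move=> T x nx.
  have [|t0 at0] := Zkernel_lift ka (e := i ∘ x).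
    rewrite comp_assoc -k''y -comp_assoc; exact: null_postcomp.
  have [|t [_ mt]] := pullback_lift (f ∘ t0) x pbS.
    by rewrite comp_assoc sq_fb -!comp_assoc at0.
  by exists t; split=> // t' mt'; apply: mm; rewrite mt.
apply: (extremal_lift hreg (r := r) (h := s ∘ n) _ mb).
  exact: (extremal_pullback hreg pbP ef').
by rewrite -(proj1 pbP) comp_assoc (proj1 pbS) -comp_assoc mn comp_idr.
Qed.

(** * The comparison from [A'] to the pullback of [b'] and [f''] *)

Section Comparison.

Variables (Q : C) (q1 : hom Q B') (q2 : hom Q A'') (c : hom A' Q).
Hypothesis pbQ : is_pullback b' f'' q1 q2.
Hypothesis c1 : q1 ∘ c = f'.
Hypothesis c2 : q2 ∘ c = a'.

(* The [Z]-kernel of [q1] is [K'']. *)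
Lemma Zkernel_comparison_left :
  exists t : hom K'' Q, null (q1 ∘ t) /\ q2 ∘ t = k'' /\ c ∘ k' = t ∘ u'.
Proof.
(* [t] pairs [k''] with the null lift of [f'' ∘ k''] along [b']. *)
have [z [nz bz]] := null_lift Zb' nk''.
have [t [t1 t2]] := pullback_lift _ _ pbQ bz.
exists t; rewrite t1 t2; do !split=> //.
apply: (pullback_ext pbQ); rewrite !comp_assoc ?c2 ?t2 //.
rewrite c1 t1; apply: (null_inj Zb') => //; first exact: null_precomp.
by rewrite !comp_assoc sq_fb' bz -!comp_assoc sq_ka'.
Qed.

(* The [Z]-kernel of [q2] is [B]. *)
Lemma comparison_extremal_of_kernel :
  extremal_epi a' -> is_Zkernel Z b b' -> null (a' ∘ a) -> extremal_epi c.
Proof.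
move=> ea' kb na.
(* [t] pairs [b] with the null lift of [b' ∘ b] along [f'']. *)
have [z [nz fz]] := null_lift Zf'' (proj1 kb).
have [t [t1 t2]] := pullback_lift _ _ pbQ (eq_sym fz).
apply: (extremal_of_Zkernel_extremal (q := q2) (t := t) (e := f) (s := a)) => //.
- by rewrite c2.
- move=> E x nx.
  have [|y bye] := Zkernel_lift kb (e := q1 ∘ x).
    rewrite comp_assoc (proj1 pbQ) -comp_assoc; exact: null_postcomp.
  exists y; apply: (pullback_ext pbQ); rewrite comp_assoc ?t1 // t2.
  apply: (null_inj Zf'') => //; first exact: null_precomp.
  by rewrite comp_assoc fz -comp_assoc bye !comp_assoc (proj1 pbQ).
- apply: (pullback_ext pbQ); rewrite !comp_assoc ?c1 ?t1 // c2 t2.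
  apply: (null_inj Zf'') => //; first exact: null_precomp.
  by rewrite !comp_assoc fz -sq_fb' -!comp_assoc sq_fb.
Qed.

Lemma comparison_extremal_of_quotient : extremal_epi u' -> extremal_epi c.
Proof.
move=> eu'; have [t [nt [t2 ct]]] := Zkernel_comparison_left.
apply: (extremal_of_Zkernel_extremal (q := q1) (t := t) _ _ eu' ct).
  by rewrite c1.
move=> E x nx.
have [|y ky] := Zkernel_lift (proj2 col'') (e := q2 ∘ x).
  rewrite comp_assoc -(proj1 pbQ) -comp_assoc; exact: null_postcomp.
exists y; apply: (pullback_ext pbQ); last by rewrite comp_assoc t2.
apply: (null_inj Zb') => //; first by rewrite comp_assoc; apply: null_precomp.
by rewrite !comp_assoc (proj1 pbQ) -!comp_assoc (comp_assoc q2) t2 ky.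
Qed.

End Comparison.

Lemma comparison_exists :
  exists (Q : C) (q1 : hom Q B') (q2 : hom Q A'') (c : hom A' Q),
    is_pullback b' f'' q1 q2 /\ q1 ∘ c = f' /\ q2 ∘ c = a'.
Proof.
have [Q [q1 [q2 pbQ]]] := pullback_exists hreg b' f''.
have [c [c1 c2]] := pullback_lift _ _ pbQ sq_fb'.
by exists Q, q1, q2, c.
Qed.

(** * Exactness of the first and of the middle row *)

Lemma first_row_exact :
  Zexact Z a a' -> Zexact Z b b' -> Zexact Z u u'.
Proof.
move=> [/regular_extremal ea' ka] [_ kb].
have ma := Zkernel_mono ka.
have mb := Zkernel_mono kb.
split; last first.
{ apply: mono_Zkernel.
  - apply: (mono_of_comp (g := k')); rewrite -sq_ka; exact: mono_comp.
  - apply: (null_of_mono mk'').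
    rewrite comp_assoc -sq_ka' -comp_assoc -sq_ka comp_assoc.
    apply: null_precomp; exact: (proj1 ka).
  - move=> E e ne.
    have [|x ax] := Zkernel_lift ka (e := k' ∘ e).
      rewrite comp_assoc sq_ka' -comp_assoc; exact: null_postcomp.
    have [|y ky] := Zkernel_lift (proj2 col) (e := x).
      apply: (null_of_mono mb).
      rewrite comp_assoc sq_fb -comp_assoc ax comp_assoc.
      exact: null_precomp.
    by exists y; apply: mk'; rewrite comp_assoc -sq_ka -comp_assoc ky. }
have [Q [q1 [q2 [c [pbQ [c1 c2]]]]]] := comparison_exists.
have ec := comparison_extremal_of_kernel pbQ c1 c2 ea' kb (proj1 ka).
have [t [nt [t2 ct]]] := Zkernel_comparison_left pbQ c1 c2.
apply: (extremal_regular hreg).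
(* The square [c ∘ k' = t ∘ u'] is a pullback, so [u'] inherits extremality from [c]. *)
apply: (extremal_pullback hreg (f := c) (g := t) (p := k')) => //.
split=> // E x y cxy.
have [|z kz] := Zkernel_lift (proj2 col') (e := x).
  by rewrite -c1 -comp_assoc cxy comp_assoc; apply: null_precomp.
exists z; split=> [|z' [kz' _]]; last by apply: mk'; rewrite kz.
split=> //; apply: mk''.
by rewrite comp_assoc -sq_ka' -comp_assoc kz -c2 -comp_assoc cxy comp_assoc t2.
Qed.

Lemma middle_row_exact :
  null (a' ∘ a) -> Zexact Z u u' -> Zexact Z b b' -> Zexact Z a a'.
Proof.
move=> na [/regular_extremal eu' ku] [/regular_extremal eb' kb].
have mb := Zkernel_mono kb.
have mu := Zkernel_mono ku.
split.
  have [Q [q1 [q2 [c [pbQ [c1 c2]]]]]] := comparison_exists.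
  apply: (extremal_regular hreg); rewrite -c2; apply: extremal_comp => //.
    exact: (extremal_pullback hreg pbQ eb').
  exact: (comparison_extremal_of_quotient pbQ c1 c2 eu').
(* The comparison [w] from [A] to the true Z-kernel [W] of [a'] lies over [B], with [g ∘ w = f]
   extremal. It is invertible because the Z-kernel of [g] lies in [K'], hence in [K]. *)
have [W [j kj]] := Zkernel_exists a'.
have mj := Zkernel_mono kj.
have [w jw] := Zkernel_lift kj na.
have [|g bg] := Zkernel_lift kb (e := f' ∘ j).
  rewrite comp_assoc sq_fb' -comp_assoc; apply: null_postcomp; exact: (proj1 kj).
have gw : g ∘ w = f by apply: mb; rewrite comp_assoc bg -comp_assoc jw.
have isow : is_iso w.
  apply: (iso_of_Zkernel_iso (q := g)); first by rewrite gw.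
  move=> E x nx.
  have [|y ky] := Zkernel_lift (proj2 col') (e := j ∘ x).
    rewrite comp_assoc -bg -comp_assoc; exact: null_postcomp.
  have [|z uz] := Zkernel_lift ku (e := y).
    apply: (null_of_mono mk'').
    rewrite comp_assoc -sq_ka' -comp_assoc ky comp_assoc.
    apply: null_precomp; exact: (proj1 kj).
  exists (k ∘ z); split.
    by apply: mj; rewrite !comp_assoc jw sq_ka -comp_assoc uz.
  move=> t wt.
  have [|t' kt'] := Zkernel_lift (proj2 col) (e := t).
    by rewrite -gw -comp_assoc wt.
  rewrite -kt'; congr (_ ∘ _); apply: mu; rewrite uz; apply: mk'.
  by rewrite comp_assoc -sq_ka -comp_assoc kt' -jw -comp_assoc wt.
have [n [_ wn]] := isow.
apply: mono_Zkernel => //.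
  by rewrite -jw; apply: mono_comp => //; apply: iso_mono.
move=> E e /(Zkernel_lift kj) [t jt].
by exists (n ∘ t); rewrite -jw -comp_assoc (comp_assoc w) wn comp_idl.
Qed.

End Coreflection.

Theorem theorem5p7
  (C : category)
  (hreg : regular_category C)
  (hproto : protomodular_category C)
  (Z : C -> Prop)
  (hpos : posetal (full_subcategory Z))
  (coref : functor C (full_subcategory Z))
  (adj : adjunction (inclusion Z) coref)
  (hcounit : forall A : C, is_mono (counit adj A))
  (hinv : inverts_monos coref)
  (K K' K'' A A' A'' B B' B'' : C)
  (u : hom K K') (u' : hom K' K'')
  (k : hom K A) (k' : hom K' A') (k'' : hom K'' A'')
  (a : hom A A') (a' : hom A' A'')
  (f : hom A B) (f' : hom A' B') (f'' : hom A'' B'')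
  (b : hom B B') (b' : hom B' B'')
  (sq_ka : a ∘ k = k' ∘ u)
  (sq_ka' : a' ∘ k' = k'' ∘ u')
  (sq_fb : b ∘ f = f' ∘ a)
  (sq_fb' : b' ∘ f' = f'' ∘ a')
  (col : Zexact Z k f)
  (col' : Zexact Z k' f')
  (col'' : Zexact Z k'' f'')
  (iso_B'_B'' : isomorphic (coref B') (coref B''))
  (iso_B''_A'' : isomorphic (coref B'') (coref A'')) :
  (isomorphic (coref B) (coref B') ->
     Zexact Z u u' -> Zexact Z a a' -> Zexact Z b b') /\
  (Zexact Z a a' -> Zexact Z b b' -> Zexact Z u u') /\
  (factors_through Z (a' ∘ a) ->
     Zexact Z u u' -> Zexact Z b b' -> Zexact Z a a').
Proof.
have Zb' := isomorphic_coref_iso hpos b' iso_B'_B''.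
have Zf'' := isomorphic_coref_iso hpos f'' (isomorphic_coref_sym iso_B''_A'').
split; [|split].
- move=> iso; have Zb := isomorphic_coref_iso hpos b iso.
  exact: (third_row_exact hreg hcounit hinv hproto sq_ka sq_ka' sq_fb
    sq_fb' col col' col'' Zb).
- exact: (first_row_exact hreg hcounit hinv hproto sq_ka sq_ka' sq_fb
    sq_fb' col col' col'' Zb' Zf'').
- exact: (middle_row_exact hreg hcounit hinv hproto sq_ka sq_ka' sq_fb
    sq_fb' col col' col'' Zb').
Qed.
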